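(* Let $f=(0.5,0.5)$ and let $\mathcal{G}$ be the family of all maximal lattice-free quadrilaterals with vertices $$(1+a,\,1-b),\quad (1-b,\,-a),\quad (-a,\,b),\quad (b,\,1+a)$$ for some $a,b>0$ with $a^2=b(1-b)$. For $k\ge1$ and $r_1,\dots,r_k\in\mathbb{Q}^2\setminus\{0\}$ let $$X(r_1,\dots,r_k)=T_f(r_1,\dots,r_k)\cap\Big\{s\in\mathbb{R}_+^k:\ \sum_{j=1}^k\psi_B(r_j)s_j\ge1\ \text{ for all } B\in\mathcal{G}\Big\}.$$ Then the smallest $\alpha>0$ such that $T_f(r_1,\dots,r_k)\subseteq\alpha X(r_1,\dots,r_k)$ (for all $k\ge 1$ and all $r_1,\dots,r_k$) is $\alpha=1.125$.
   Context: A maximal lattice-free convex set in $\mathbb{R}^2$ is a convex set with no point of $\mathbb{Z}^2$ in its interior that is inclusion-maximal with this property. For a maximal lattice-free convex set $B\subset\mathbb{R}^2$ containing $f$ in its interior, $\psi_B:\mathbb{R}^2\to\mathbb{R}_+$ is defined by $\psi_B(0)=0$ and, for $r\ne 0$, $\psi_B(r)=1/\lambda$ if there is $\lambda>0$ with $f+\lambda r$ on the boundary of $B$, and $\psi_B(r)=0$ otherwise. The triangle closure is $$T_f(r_1,\dots,r_k)=\Big\{s\in\mathbb{R}_+^k:\ \sum_{j=1}^k\psi_B(r_j)s_j\ge 1\ \text{ for every maximal lattice-free triangle } B \text{ with } f \text{ in its interior}\Big\}.$$ Scaling convention: for $\alpha>0$ and a set $A$ defined by inequalities $a^ix\ge b_i$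 with $a^i\ge0$, $b_i\ge0$, the set $\alpha A$ is defined by the inequalities $\alpha a^ix\ge b_i$, i.e. $\alpha A=\{x:\alpha x\in A\}$. *)

(* Defs.v *)
From HB Require Import structures.
From mathcomp Require Import all_boot all_order all_algebra.
From mathcomp Require Import all_classical all_reals all_analysis.

Set Implicit Arguments.
Unset Strict Implicit.
Unset Printing Implicit Defensive.

Import Order.TTheory GRing.Theory Num.Theory.
Import numFieldNormedType.Exports.

Local Open Scope classical_set_scope.
Local Open Scope ring_scope.

Definition point (R : realType) (x y : R) : 'rV[R]_2 :=
  \row_(j < 2) [:: x; y]`_j.

Definition boundary (T : topologicalType) (B : set T) : set T :=
  closure B `\` B°.

Definition convex_hull (R : realType) (A : set 'rV[R]_2) : set 'rV[R]_2 :=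
  smallest (@convex_set R 'rV[R]_2) A.

Definition lattice_free_convex (R : realType) (B : set 'rV[R]_2) : Prop :=
  @convex_set R 'rV[R]_2 B /\ forall z : 'rV[int]_2, ~ B° (map_mx intr z).

Definition maximal_lattice_free (R : realType) (B : set 'rV[R]_2) : Prop :=
  lattice_free_convex B /\
  forall C : set 'rV[R]_2, lattice_free_convex C -> B `<=` C -> C = B.

(* For [size vs >= 3] this says that B is a nondegenerate convex polygon whose
   set of vertices is exactly vs: the points are distinct and none is in the
   hull of the others.  The order of vs is irrelevant. *)
Definition polygon_with_vertices (R : realType) (vs : seq 'rV[R]_2)
    (B : set 'rV[R]_2) : Prop :=
  [/\ uniq vs, B = convex_hull [set` vs] &
      forall v, v \in vs -> ~ convex_hull ([set` vs] `\ v) v].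

Definition triangle (R : realType) (B : set 'rV[R]_2) : Prop :=
  exists2 vs : seq 'rV[R]_2, size vs = 3%N & polygon_with_vertices vs B.

(* [xget 0] returns some element of the set, or 0 if the set is empty, and
   0^-1 = 0.  When B is convex with f in its interior there is at most one such
   lambda. *)
Definition psi (R : realType) (f : 'rV[R]_2) (B : set 'rV[R]_2)
    (r : 'rV[R]_2) : R :=
  if r == 0 then 0
  else (xget 0 [set lambda : R |
                0 < lambda /\ boundary B (f + lambda *: r)])^-1.

Definition cut_closure (R : realType) (f : 'rV[R]_2)
    (F : set (set 'rV[R]_2)) (k : nat) (r : 'I_k -> 'rV[R]_2) : set 'rV[R]_k :=
  [set s | (forall j, 0 <= s 0 j) /\
           forall B, F B -> 1 <= \sum_(j < k) psi f B (r j) * s 0 j].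

Definition triangle_closure (R : realType) (f : 'rV[R]_2) (k : nat)
    (r : 'I_k -> 'rV[R]_2) : set 'rV[R]_k :=
  cut_closure f [set B | [/\ maximal_lattice_free B, triangle B & B° f]] r.

Definition quadrilateral_family (R : realType) : set (set 'rV[R]_2) :=
  [set B | maximal_lattice_free B /\
     exists a b : R, [/\ 0 < a, 0 < b, a ^+ 2 = b * (1 - b) &
       polygon_with_vertices
         [:: point (1 + a) (1 - b); point (1 - b) (- a);
             point (- a) b; point b (1 + a)] B]].

Definition half_point (R : realType) : 'rV[R]_2 := point 2^-1 2^-1.

Definition X_relaxation (R : realType) (k : nat) (r : 'I_k -> 'rV[R]_2) :
    set 'rV[R]_k :=
  triangle_closure (half_point R) r `&`
  cut_closure (half_point R) (@quadrilateral_family R) r.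

(* Multiplying every left-hand side a^i x of a^i x >= b_i by alpha gives
   {x : alpha x \in A}, not the Minkowski dilation. *)
Definition cut_scale (R : realType) (k : nat) (alpha : R) (A : set 'rV[R]_k) :
    set 'rV[R]_k :=
  [set s | A (alpha *: s)].

Definition is_least (R : realType) (A : set R) (m : R) : Prop :=
  A m /\ lbound A m.

(* Main.v *)
(* Translate f to the origin. A member of the family is then the square with
   vertices v, Rv, -v, -Rv, where R is the quarter turn and v = (p, q) with
   p = 1/2 + a, q = 1/2 - b, so that p^2 + q^2 = p and |q| < p. If B is the
   polygon {x : g_i x <= 1}, then psi_B is the sublinear function
   max (0, max_i g_i).

   Upper bound: averaging psi_T over the four rotations of a triangle T gives a
   sublinear function, so it is at most 9/8 times psi of the square as soon as
   psi_T (v) + psi_T (Rv) + psi_T (-v) + psi_T (-Rv) <= 9/2. Suitable triangles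
   have their base on x = -1/2 and their other two edges through (1/2, 1/2) and
   (1/2, -1/2); with t = |q| / p the best sum found is 4 (1 + 3t) / (1 + t)^2,
   which is at most 9/2 with equality at t = 1/3.

   Lower bound: take t = 1/3, i.e. the rays (3, 1), (-1, 3), (-3, -1), (1, -3),
   and s = (1/15, 1/15, 1/15, 1/15). Some edge of a lattice-free triangle cuts
   off two corners of the unit square around f, and linear programming duality
   then bounds the sum of psi_T over the four rays below by 15, whereas every
   ray contributes only 10/3 for the square. *)
Require Import Defs.
From HB Require Import structures.
From mathcomp Require Import all_boot all_order all_algebra.
From mathcomp Require Import all_classical all_reals all_analysis.
From mathcomp Require Import ring lra.

Set Implicit Arguments.
Unset Strict Implicit.
Unset Printing Implicit Defensive.

Import Order.TTheory GRing.Theory Num.Theory.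
Import numFieldNormedType.Exports.

Local Open Scope classical_set_scope.
Local Open Scope ring_scope.

(* [point] itself is shadowed by the base point of a pointedType. *)
Local Notation pt := Defs.point.

(** * Linear functionals, polyhedra around [f] and their gauges *)

Definition dot (R : realType) (g x : 'rV[R]_2) : R :=
  g 0 0 * x 0 0 + g 0 1 * x 0 1.

Definition polyhedron (R : realType) (f : 'rV[R]_2) (gs : seq 'rV[R]_2) :
    set 'rV[R]_2 :=
  [set x | forall g, g \in gs -> dot g (x - f) <= 1].

(** Starting the maximum at 0 gives the value 0 on recession directions, in agreement with the
    default value of [psi] there. *)
Definition gauge (R : realType) (gs : seq 'rV[R]_2) (x : 'rV[R]_2) : R :=
  \big[Num.max/0]_(g <- gs) dot g x.

Lemma dotD (R : realType) (g x y : 'rV[R]_2) :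
  dot g (x + y) = dot g x + dot g y.
Proof. by rewrite /dot !mxE; ring. Qed.

Lemma dotZ (R : realType) (g x : 'rV[R]_2) (a : R) :
  dot g (a *: x) = a * dot g x.
Proof. by rewrite /dot !mxE; ring. Qed.

Lemma dotN (R : realType) (g x : 'rV[R]_2) : dot g (- x) = - dot g x.
Proof. by rewrite -scaleN1r dotZ mulN1r. Qed.

Lemma dotNl (R : realType) (g x : 'rV[R]_2) : dot (- g) x = - dot g x.
Proof. by rewrite /dot !mxE; ring. Qed.

Lemma dot0r (R : realType) (g : 'rV[R]_2) : dot g 0 = 0.
Proof. by rewrite /dot !mxE !mulr0 addr0. Qed.

Lemma dot_continuous (R : realType) (g : 'rV[R]_2) : continuous (dot g).
Proof.
move=> x.
have h (i : 'I_2) : {for x, continuous (fun y : 'rV[R]_2 => g 0 i * y 0 i)}.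
  apply: continuousM; first exact: cst_continuous.
  exact: (@coord_continuous R 1 2 0 i x).
exact: continuousD (h 0) (h 1).
Qed.

Lemma dot_shift_continuous (R : realType) (f g : 'rV[R]_2) :
  continuous (fun x : 'rV[R]_2 => dot g (x - f)).
Proof.
move=> x; rewrite (_ : (fun _ => _) = (fun y => dot g y + dot g (- f))).
  by apply: continuousD; [exact: dot_continuous|exact: cst_continuous].
by apply/funext => y; rewrite dotD.
Qed.

(** * Convex sets, their interiors and convex hulls *)

Section convexity.
Variables (R : realType) (C : set 'rV[R]_2).

Lemma convex_setP :
  @convex_set R 'rV[R]_2 C <->
  forall x y t, 0 <= t -> t <= 1 -> C x -> C y -> C (t *: x + (1 - t) *: y).
Proof.
split=> [cC x y t t0 t1 Cx Cy|cC x y t].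
  by have := cC x y (Itv01 t0 t1); rewrite !inE; apply.
by rewrite !inE => Cx Cy; apply: cC.
Qed.

Lemma interior_ray (x u : 'rV[R]_2) :
  C° x -> exists2 t, 0 < t & C (x + t *: u).
Proof.
move=> /nbhs_ballP[e /= e0 sub]; have n0 : 0 < `|u| + 1.
  by rewrite ltr_wpDl.
have [t t0 tE] : exists2 t, 0 < t & t * `|u| = e / 2 - t.
  (* Dividing by [|u| + 1] instead of [|u|] also covers [u = 0]. *)
  exists (e / 2 / (`|u| + 1)); first by rewrite !divr_gt0.
  by field; rewrite gt_eqF.
exists t => //; apply: sub; rewrite -ball_normE /=.
rewrite opprD addrA subrr add0r normrN normrZ gtr0_norm// tE; lra.
Qed.

(** The homothety with centre [x] and ratio [t] maps the ball of radius [e] around [y] onto the ball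
    of radius [t * e] around the combination; [w] below is the preimage of [z]. *)
Lemma convex_interior (x y : 'rV[R]_2) (t : R) :
  @convex_set R 'rV[R]_2 C -> 0 < t -> t <= 1 -> C° y -> C x ->
  C° (t *: y + (1 - t) *: x).
Proof.
move=> /convex_setP cC t0 t1 /nbhs_ballP[e /= e0 sub] Cx.
apply/nbhs_ballP; exists (t * e) => /=; first exact: mulr_gt0.
move=> z; rewrite -ball_normE /= => yz.
pose w := y + t^-1 *: (z - (t *: y + (1 - t) *: x)).
have -> : z = t *: w + (1 - t) *: x.
  rewrite /w scalerDr scalerA divff ?gt_eqF// scale1r addrAC addrC.
  by rewrite subrK.
apply: cC => //; first exact: ltW.
apply: sub; rewrite -ball_normE /= /w opprD addrA subrr add0r normrN normrZ.
rewrite distrC gtr0_norm ?invr_gt0//.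
by rewrite mulrC ltr_pdivrMr// mulrC.
Qed.

End convexity.

Lemma sub_convex_hull (R : realType) (A : set 'rV[R]_2) : A `<=` convex_hull A.
Proof. exact: sub_gen_smallest. Qed.

Lemma convex_hull_convex (R : realType) (A : set 'rV[R]_2) :
  @convex_set R 'rV[R]_2 (convex_hull A).
Proof.
apply/convex_setP => x y t t0 t1 hx hy C [cC AC].
by have /convex_setP h := cC; apply: h => //; [apply: hx|apply: hy].
Qed.

Lemma convex_halfspace (R : realType) (f g : 'rV[R]_2) (c : R) :
  @convex_set R 'rV[R]_2 [set x | dot g (x - f) <= c].
Proof.
apply/convex_setP => x y t t0 t1 /= gx gy.
rewrite dotD dotN in gx; rewrite dotD dotN in gy.
rewrite !dotD dotN !dotZ; nra.
Qed.

Lemma convex_comb3 (R : realType) (C : set 'rV[R]_2) (x y z : 'rV[R]_2)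
    (a b c : R) :
  @convex_set R 'rV[R]_2 C -> 0 <= a -> 0 <= b -> 0 <= c -> a + b + c = 1 ->
  C x -> C y -> C z -> C (a *: x + b *: y + c *: z).
Proof.
move=> /convex_setP cC a0 b0 c0 abc Cx Cy Cz.
have [ab0|ab0] := eqVneq (a + b) 0.
  have -> : a = 0 by lra.
  have -> : b = 0 by lra.
  have -> : c = 1 by lra.
  by rewrite !scale0r !add0r scale1r.
have abp : 0 < a + b by rewrite lt_def ab0 addr_ge0.
have -> : a *: x + b *: y + c *: z =
    (a + b) *: ((a / (a + b)) *: x + (1 - a / (a + b)) *: y)
    + (1 - (a + b)) *: z.
  rewrite scalerDr !scalerA; congr (_ *: _ + _ *: _ + _ *: _); last lra.
    by field.
  by field.
apply: (cC) => //; [lra|lra|].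
apply: (cC) => //; first by rewrite divr_ge0// ltW.
by rewrite ler_pdivrMr//; lra.
Qed.

(** * Interior, boundary and [psi] of a polyhedron *)

Section polyhedra.
Variables (R : realType) (f : 'rV[R]_2).
Implicit Types gs : seq 'rV[R]_2.

Lemma convex_polyhedron gs : @convex_set R 'rV[R]_2 (polyhedron f gs).
Proof.
apply/convex_setP => x y t t0 t1 hx hy g ggs.
by have /convex_setP := @convex_halfspace R f g 1; apply=> //;
  [apply: hx|apply: hy].
Qed.

(** An interior point can be moved slightly away from [f], which would push a constraint with value
    1 beyond 1. Conversely, finitely many strict inequalities define an open set. *)
Lemma polyhedron_interior gs :
  (polyhedron f gs)° = [set x | forall g, g \in gs -> dot g (x - f) < 1].
Proof.
apply/seteqP; split=> x /=.
  move=> ix g ggs; have [t t0 /(_ _ ggs)] := interior_ray (x - f) ix.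
  rewrite addrAC dotD dotZ.
  have [|] := ltP 0 (dot g (x - f)); nra.
elim: gs => [|g gs IH] xgs.
  rewrite (_ : polyhedron f [::] = setT) ?interiorT//.
  by apply/seteqP; split => // y _ g; rewrite in_nil.
have -> : polyhedron f (g :: gs) =
    [set y | dot g (y - f) <= 1] `&` polyhedron f gs.
  apply/seteqP; split=> [y yP|y [yg yP] h].
    by split=> [|h hgs]; apply: yP; rewrite inE ?eqxx// hgs orbT.
  by rewrite inE => /orP[/eqP->//|]; exact: yP.
rewrite interiorI; split; last first.
  by apply: IH => h hgs; apply: xgs; rewrite inE hgs orbT.
have oH : open [set y | dot g (y - f) < 1].
  rewrite (_ : mkset _ = (fun y => dot g (y - f)) @^-1` [set c | c < 1])//.
  apply: open_comp; last exact: open_lt.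
  by move=> y _; exact: dot_shift_continuous.
have sub : [set y | dot g (y - f) < 1] `<=` [set y | dot g (y - f) <= 1]°.
  by rewrite -open_subsetE// => y /= /ltW.
exact/sub/xgs/mem_head.
Qed.

Lemma polyhedron_closure gs : closure (polyhedron f gs) = polyhedron f gs.
Proof.
apply/esym/closure_id; rewrite /polyhedron.
rewrite (_ : mkset _ = \bigcap_(g in [set` gs])
  ((fun x => dot g (x - f)) @^-1` [set y | y <= 1])); last by [].
apply: closed_bigI => g _; apply: preimage_closed.
  by move=> x _; exact: dot_shift_continuous.
exact: closed_le.
Qed.

Lemma gauge_ge0 gs x : 0 <= gauge gs x.
Proof. exact: bigmax_ge_id. Qed.

Lemma le_gauge gs g x : g \in gs -> dot g x <= gauge gs x.
Proof.
rewrite /gauge; elim: gs => // h gs IH; rewrite inE big_cons le_max.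
by case/orP => [/eqP->|/IH->]; rewrite ?lexx ?orbT.
Qed.

Lemma gauge_leP gs x m :
  reflect (0 <= m /\ forall g, g \in gs -> dot g x <= m) (gauge gs x <= m).
Proof.
apply: (iffP idP) => [h|[m0 h]].
  split; first exact: le_trans (gauge_ge0 gs x) h.
  by move=> g ggs; exact: le_trans (le_gauge x ggs) h.
rewrite /gauge big_seq; elim/big_ind: _ => //.
by move=> a b am bm; rewrite ge_max am.
Qed.

Lemma gauge_ltP gs x m :
  reflect (0 < m /\ forall g, g \in gs -> dot g x < m) (gauge gs x < m).
Proof.
apply: (iffP idP) => [h|[m0 h]].
  split; first exact: le_lt_trans (gauge_ge0 gs x) h.
  by move=> g ggs; exact: le_lt_trans (le_gauge x ggs) h.
rewrite /gauge big_seq; elim/big_ind: _ => //.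
by move=> a b am bm; rewrite gt_max am.
Qed.

Lemma gaugeZ gs a x : 0 <= a -> gauge gs (a *: x) = a * gauge gs x.
Proof.
move=> a0; rewrite /gauge; elim: gs => [|g gs IH].
  by rewrite !big_nil mulr0.
by rewrite !big_cons IH dotZ maxr_pMr.
Qed.

Lemma gaugeD gs x y : gauge gs (x + y) <= gauge gs x + gauge gs y.
Proof.
apply/gauge_leP; split; first by rewrite addr_ge0 ?gauge_ge0.
by move=> g ggs; rewrite dotD lerD ?le_gauge.
Qed.

Lemma boundary_polyhedron gs x :
  boundary (polyhedron f gs) x <-> gauge gs (x - f) = 1.
Proof.
rewrite /boundary polyhedron_closure polyhedron_interior.
split=> [[xP xI]|xg].
  apply/le_anti/andP; split; first by apply/gauge_leP.
  rewrite leNgt; apply/negP => /gauge_ltP[_]; exact: xI.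
split; first by have /gauge_leP[] : gauge gs (x - f) <= 1 by rewrite xg.
move=> xI; have : gauge gs (x - f) < 1 by apply/gauge_ltP.
by rewrite xg ltxx.
Qed.

(** The ray of [r] meets the boundary where [l * gauge gs r = 1]. If the gauge vanishes, no such [l]
    exists and [xget 0] with [0^-1 = 0] still returns the gauge. *)
Lemma psi_polyhedron gs r : psi f (polyhedron f gs) r = gauge gs r.
Proof.
rewrite /psi; have [->|r0] := eqVneq r 0.
  by rewrite -(scale0r (0 : 'rV[R]_2)) gaugeZ// mul0r.
have bE l : 0 < l ->
    boundary (polyhedron f gs) (f + l *: r) <-> l * gauge gs r = 1.
  by move=> l0; rewrite boundary_polyhedron addrC addKr gaugeZ// ltW.
have [g0|g0] := eqVneq (gauge gs r) 0.
  rewrite xgetPN ?g0 ?invr0// => l [l0 /(bE _ l0)].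
  by rewrite g0 mulr0 => /esym/eqP; rewrite oner_eq0.
have gp : 0 < gauge gs r by rewrite lt_def g0 gauge_ge0.
rewrite (@xget_unique _ _ _ (gauge gs r)^-1) ?invrK//.
- by split; rewrite ?invr_gt0// bE ?invr_gt0// mulVf.
- move=> l [l0 /(bE _ l0)] lg.
  by rewrite -[LHS](mulfK g0) lg mul1r.
Qed.

End polyhedra.

(** * Maximality of lattice-free polyhedra *)

Lemma row2P (R : realType) (x y : 'rV[R]_2) :
  x 0 0 = y 0 0 -> x 0 1 = y 0 1 -> x = y.
Proof.
move=> e0 e1; apply/rowP => -[[|[|//]] i2].
  by rewrite (_ : Ordinal i2 = 0)//; apply: val_inj.
by rewrite (_ : Ordinal i2 = 1)//; apply: val_inj.
Qed.

(* A convex set strictly containing the polyhedron contains in its interior the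
   lattice point lying in the relative interior of the violated edge. *)
Lemma maximal_polyhedron (R : realType) (f : 'rV[R]_2) (gs : seq 'rV[R]_2) :
  (forall z : 'rV[int]_2, exists2 g, g \in gs & 1 <= dot g (map_mx intr z - f)) ->
  (forall g, g \in gs -> exists2 z : 'rV[int]_2, dot g (map_mx intr z - f) = 1 &
     forall h, h \in gs -> h != g -> dot h (map_mx intr z - f) < 1) ->
  maximal_lattice_free (polyhedron f gs).
Proof.
move=> blocked tight; split.
  split=> [|z]; first exact: convex_polyhedron.
  rewrite polyhedron_interior => zI; have [g ggs] := blocked z.
  by rewrite leNgt zI.
move=> C [cC freeC] sC; apply/seteqP; split=> // x Cx g ggs.
rewrite leNgt; apply/negP => gx; have [z gz hz] := tight g ggs.
apply: (freeC z); set y : 'rV[R]_2 := map_mx intr z in gz hz *.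
pose hs := [seq h <- gs | h != g].
have [|t t0 ht] := @interior_ray _ (polyhedron f hs) y (y - x).
  rewrite polyhedron_interior => h; rewrite mem_filter => /andP[? ?].
  exact: hz.
(* The full step [t] keeps the other constraints at most 1, so half of it keeps them strictly below
   1. The constraint [g] drops below 1 because it is 1 at [y] and larger at [x]. *)
pose w := y + (t / 2) *: (y - x).
have wI : C° w.
  apply: (interiorS sC); rewrite polyhedron_interior => h hgs.
  have dE s : dot h (y + s *: (y - x) - f) =
      dot h (y - f) + s * (dot h (y - f) - dot h (x - f)).
    by rewrite !(dotD, dotZ, dotN); ring.
  rewrite /w dE; have [->|hg] := eqVneq h g; first by rewrite gz; nra.
  have : dot h (y + t *: (y - x) - f) <= 1.
    by apply: ht; rewrite mem_filter hg.
  rewrite dE; have := hz h hgs hg; lra.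
have -> : y = (1 + t / 2)^-1 *: w + (1 - (1 + t / 2)^-1) *: x.
  have nz : 1 + t / 2 != 0 by rewrite gt_eqF//; lra.
  by apply: row2P; rewrite !mxE; field; rewrite ?nz//; lra.
apply: convex_interior => //.
  by rewrite invr_gt0; lra.
by rewrite invf_le1; lra.
Qed.

(** * Triangles: passing between vertices and edge functionals *)

Definition cross (R : realType) (d e : 'rV[R]_2) : R :=
  d 0 0 * e 0 1 - d 0 1 * e 0 0.

Definition normal (R : realType) (d e : 'rV[R]_2) : 'rV[R]_2 :=
  pt (e 0 1 - d 0 1) (d 0 0 - e 0 0).

(** When [cross d e] is nonzero, this is the functional with value 1 at both [d] and [e], the polar
    dual of the line through them. *)
Definition edge (R : realType) (d e : 'rV[R]_2) : 'rV[R]_2 :=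
  (cross d e)^-1 *: normal d e.

Lemma dot_normall (R : realType) (d e : 'rV[R]_2) : dot (normal d e) d = cross d e.
Proof. by rewrite /dot /cross /normal !mxE /=; ring. Qed.

Lemma dot_normalr (R : realType) (d e : 'rV[R]_2) : dot (normal d e) e = cross d e.
Proof. by rewrite /dot /cross /normal !mxE /=; ring. Qed.

Lemma dot_edge (R : realType) (d e x : 'rV[R]_2) :
  dot (edge d e) x = dot (normal d e) x / cross d e.
Proof. by rewrite /dot /edge !mxE; ring. Qed.

Lemma hull_halfspace (R : realType) (f g : 'rV[R]_2) (c : R) (vs : seq 'rV[R]_2) :
  (forall v, v \in vs -> dot g (v - f) <= c) ->
  forall x, convex_hull [set` vs] x -> dot g (x - f) <= c.
Proof.
move=> gvs x; apply: (@smallest_sub _ _ _ [set x | dot g (x - f) <= c]).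
  exact: convex_halfspace.
by move=> v /= /gvs.
Qed.

Lemma eq_convex_hull (R : realType) (vs ws : seq 'rV[R]_2) :
  vs =i ws -> convex_hull [set` vs] = convex_hull [set` ws].
Proof.
by move=> eqvs; congr convex_hull; apply/seteqP; split=> x /=; rewrite eqvs.
Qed.

Lemma triangle_hull (R : realType) (f d0 d1 d2 : 'rV[R]_2) :
  0 < cross d0 d1 -> 0 < cross d1 d2 -> 0 < cross d2 d0 ->
  convex_hull [set` [:: f + d0; f + d1; f + d2]] =
  polyhedron f [:: edge d1 d2; edge d2 d0; edge d0 d1].
Proof.
move=> c01 c12 c20; apply/seteqP; split=> x.
  move=> hx g ggs; apply: hull_halfspace hx => v.
  move: ggs; rewrite !inE => /or3P[]/eqP-> /or3P[]/eqP->;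
    rewrite addrAC subrr add0r dot_edge ler_pdivrMr// mul1r;
    rewrite ?dot_normall ?dot_normalr//;
    move: c01 c12 c20; rewrite /cross /dot /normal !mxE /=; lra.
move=> xP; set S := cross d0 d1 + cross d1 d2 + cross d2 d0.
have S0 : 0 < S by rewrite /S; lra.
(* Barycentric coordinate of [x] at the vertex opposite to the edge [d e]; [S] is twice the area of
   the triangle. *)
pose b d e := (cross d e - dot (normal d e) (x - f)) / S.
have b_ge0 d e : 0 < cross d e ->
    edge d e \in [:: edge d1 d2; edge d2 d0; edge d0 d1] -> 0 <= b d e.
  move=> cde /xP; rewrite dot_edge ler_pdivrMr// mul1r => h.
  by rewrite /b divr_ge0 ?subr_ge0// ltW.
have -> : x = b d1 d2 *: (f + d0) + b d2 d0 *: (f + d1) + b d0 d1 *: (f + d2).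
  apply: row2P; rewrite !mxE /b /dot /normal /cross !mxE /= /S /cross;
  field; move: S0; rewrite /S /cross => /gt_eqF; lra.
apply: (convex_comb3 (@convex_hull_convex _ _));
  try (by apply: b_ge0; rewrite // !inE eqxx ?orbT);
  try (by apply: sub_convex_hull; rewrite /= !inE eqxx ?orbT).
rewrite /b /dot /normal !mxE /= /S /cross; field.
move: S0; rewrite /S /cross => /gt_eqF; lra.
Qed.

Section triangles.
Variables (R : realType) (f : 'rV[R]_2).
Implicit Types a b c d e g : 'rV[R]_2.

Lemma crossC d e : cross d e = - cross e d.
Proof. by rewrite /cross; ring. Qed.

Lemma cross_gt0_neq d e : 0 < cross d e -> (d == e) = false.
Proof.
by move=> de; apply/eqP => eqde; move: de; rewrite eqde /cross mulrC subrr ltxx.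
Qed.

Lemma cross_edge a b c : cross a b != 0 -> cross b c != 0 ->
  cross (edge a b) (edge b c) =
  (cross a b + cross b c + cross c a) / (cross a b * cross b c).
Proof.
move=> ab bc; rewrite {1}/cross /edge /normal !mxE /=.
move: ab bc; rewrite /cross => ab bc; field; exact/andP.
Qed.

Lemma edge_edge a b c : cross a b != 0 -> cross b c != 0 ->
  cross a b + cross b c + cross c a != 0 ->
  edge (edge a b) (edge b c) = b.
Proof.
move=> ab bc S; rewrite /edge -/(edge a b) -/(edge b c) cross_edge// /normal /edge.
by apply: row2P; rewrite !mxE /=; move: ab bc S; rewrite /cross => ab bc S;
  field; apply/and3P.
Qed.

Lemma extreme_not_hull (vs : seq 'rV[R]_2) v g (a : R) :
  (forall w, w \in vs -> w != v -> dot g (w - f) <= a) -> a < dot g (v - f) ->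
  ~ convex_hull ([set` vs] `\ v) v.
Proof.
move=> vsP va hv; suff : dot g (v - f) <= a by rewrite leNgt va.
move: hv; apply: (@smallest_sub _ _ _ [set x | dot g (x - f) <= a]).
  exact: convex_halfspace.
by move=> w /= [wvs /eqP wv]; exact: vsP.
Qed.

(** The vertices are the polar duals of consecutive pairs of functionals. By [edge_edge] the edges
    of these vertices are the [g]s again, so [triangle_hull] applies. *)
Lemma triangle_polyhedron g0 g1 g2 :
  0 < cross g0 g1 -> 0 < cross g1 g2 -> 0 < cross g2 g0 ->
  triangle (polyhedron f [:: g0; g1; g2]).
Proof.
move=> c01 c12 c20.
have pos a b c : 0 < cross a b -> 0 < cross b c -> 0 < cross c a ->
    0 < cross (edge a b) (edge b c) /\ edge (edge a b) (edge b c) = b.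
  move=> ab bc ca; have S : 0 < cross a b + cross b c + cross c a by lra.
  rewrite cross_edge ?edge_edge ?gt_eqF//; split=> //.
  by rewrite divr_gt0 ?mulr_gt0.
have [d01 e2] := pos _ _ _ c12 c20 c01.
have [d12 e0] := pos _ _ _ c20 c01 c12.
have [d20 e1] := pos _ _ _ c01 c12 c20.
set d0 := edge g1 g2 in d01 d20 e2 e1 *; set d1 := edge g2 g0 in d01 d12 e2 e0 *.
set d2 := edge g0 g1 in d12 d20 e0 e1 *.
have hull := triangle_hull f d01 d12 d20; rewrite e0 e1 e2 in hull.
exists [:: f + d0; f + d1; f + d2] => //; split=> //.
  rewrite /= !inE !(inj_eq (addrI f)) (cross_gt0_neq d01) (cross_gt0_neq d12).
  by rewrite eq_sym (cross_gt0_neq d20).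
have far d e c : 0 < cross d e -> 0 < cross e c -> 0 < cross c d ->
    dot (edge d e) c < 1 /\ (dot (edge d e) d = 1 /\ dot (edge d e) e = 1).
  move=> de ec cd; rewrite !dot_edge dot_normall dot_normalr divff ?gt_eqF//.
  split=> //; rewrite ltr_pdivrMr// mul1r.
  by move: de ec cd; rewrite /cross /dot /normal !mxE /=; lra.
have [x0 [y0 z0]] := far _ _ _ d12 d20 d01.
have [x1 [y1 z1]] := far _ _ _ d20 d01 d12.
have [x2 [y2 z2]] := far _ _ _ d01 d12 d20.
have sf x : f + x - f = x by rewrite addrAC subrr add0r.
(* The opposite edge functional separates a vertex from the other two: it is 1 on those and below 1
   at the vertex. *)
move=> v; rewrite !inE => /or3P[]/eqP->;
  [apply: (@extreme_not_hull _ _ (- edge d1 d2) (-1))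
  |apply: (@extreme_not_hull _ _ (- edge d2 d0) (-1))
  |apply: (@extreme_not_hull _ _ (- edge d0 d1) (-1))];
  rewrite ?sf ?dotNl; try lra;
  move=> w; rewrite !inE => /or3P[]/eqP->; rewrite ?eqxx// => _;
  rewrite sf dotNl; lra.
Qed.

(** A small move from [f] in direction [d - c] stays in the hull and raises [normal d e] from 0 to
    [t] times twice the area, while [cross d e] is its maximum on the hull. *)
Lemma hull_cross_gt0 d e c :
  0 < cross d e + cross e c + cross c d ->
  (convex_hull [set` [:: f + d; f + e; f + c]])° f -> 0 < cross d e.
Proof.
move=> S fI; have [t t0 ht] := interior_ray (d - c) fI.
have : dot (normal d e) (f + t *: (d - c) - f) <= cross d e.
  apply: hull_halfspace ht => v; rewrite !inE => /or3P[]/eqP->;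
    rewrite addrAC subrr add0r ?dot_normall ?dot_normalr//.
  by move: S; rewrite /cross /dot /normal !mxE /=; lra.
rewrite addrAC subrr add0r => h.
have {h} : t * (cross d e + cross e c + cross c d) <= cross d e.
  by apply: le_trans h; rewrite le_eqVlt; apply/orP; left; apply/eqP;
    rewrite /cross /dot /normal !mxE /=; ring.
by apply: lt_le_trans; rewrite mulr_gt0.
Qed.

Lemma triangle_is_polyhedron (B : set 'rV[R]_2) : triangle B -> B° f ->
  exists g0 g1 g2, B = polyhedron f [:: g0; g1; g2].
Proof.
case=> -[|v0 [|v1 [|v2 [|//]]]]// _ [uq -> _] fI.
pose d0 := v0 - f; pose d1 := v1 - f; pose d2 := v2 - f.
have vE : [:: v0; v1; v2] = [:: f + d0; f + d1; f + d2].
  by rewrite /d0 /d1 /d2 ![f + _]addrC !subrK.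
rewrite vE in uq fI *; clear vE; clearbody d0 d1 d2.
have pos a b c : [:: f + a; f + b; f + c] =i [:: f + d0; f + d1; f + d2] ->
    0 < cross a b + cross b c + cross c a ->
    exists g0 g1 g2, convex_hull [set` [:: f + d0; f + d1; f + d2]] =
      polyhedron f [:: g0; g1; g2].
  move=> eqv S; rewrite -(eq_convex_hull eqv).
  exists (edge b c), (edge c a), (edge a b); apply: triangle_hull.
  - by apply: (@hull_cross_gt0 a b c) => //; rewrite (eq_convex_hull eqv).
  - apply: (@hull_cross_gt0 b c a); first lra.
    rewrite (@eq_convex_hull _ _ [:: f + d0; f + d1; f + d2])// => x.
    by rewrite -eqv !inE orbC -orbA orbCA orbA orbC orbCA.
  - apply: (@hull_cross_gt0 c a b); first lra.
    rewrite (@eq_convex_hull _ _ [:: f + d0; f + d1; f + d2])// => x.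
    by rewrite -eqv !inE orbC -orbA.
case: (ltgtP 0 (cross d0 d1 + cross d1 d2 + cross d2 d0)) => [S|S|S].
- by apply: (pos d0 d1 d2).
- apply: (pos d0 d2 d1); first by move=> x; rewrite !inE [X in _ || X]orbC.
  by rewrite (crossC d0 d2) (crossC d2 d1) (crossC d1 d0); lra.
(* Zero area: the hull lies on a level set of [normal d0 d1], so an interior point forces this
   normal to vanish and [d0 = d1], against distinctness. *)
- have [t t0 ht] := interior_ray (normal d0 d1) fI.
  have le x : convex_hull [set` [:: f + d0; f + d1; f + d2]] x ->
      dot (normal d0 d1) (x - f) = cross d0 d1.
    move=> hx; apply/le_anti/andP; split; last rewrite -lerN2 -dotNl.
      apply: hull_halfspace hx => v; rewrite !inE => /or3P[]/eqP->;
        rewrite addrAC subrr add0r ?dot_normall ?dot_normalr//.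
      by move: S; rewrite /cross /dot /normal !mxE /=; lra.
    apply: hull_halfspace hx => v; rewrite !inE => /or3P[]/eqP->;
      rewrite addrAC subrr add0r dotNl ?dot_normall ?dot_normalr//.
    by move: S; rewrite /cross /dot /normal !mxE /=; lra.
  have := le _ ht; rewrite addrAC -(le _ (interior_subset fI)) subrr add0r dot0r.
  rewrite dotZ => /eqP; rewrite mulf_eq0 gt_eqF//= => /eqP n0.
  move: n0; rewrite /dot /normal !mxE /= -!expr2 => /eqP.
  rewrite paddr_eq0 ?sqr_ge0// !sqrf_eq0 !subr_eq0 => /andP[/eqP e1 /eqP e0].
  move: uq; rewrite /= !inE (_ : d0 = d1) ?eqxx//.
  by apply: row2P; rewrite ?e0 ?e1.
Qed.

End triangles.

(** * Quarter turns around [f] and averaging over them *)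

Definition turn (R : realType) (x : 'rV[R]_2) : 'rV[R]_2 := pt (- x 0 1) (x 0 0).

(* The pair (s, t) of signs stands for the corner f + (s, t) / 2 of the unit
   square around f. Every corner is cut off by an edge that also cuts off the
   whole quadrant behind it, and every edge passes through a corner that lies
   strictly inside all other edges. *)
Definition cornered (R : realType) (gs : seq 'rV[R]_2) : Prop :=
  (forall s t : R, s ^+ 2 = 1 -> t ^+ 2 = 1 -> exists2 g, g \in gs &
     [/\ 0 <= s * g 0 0, 0 <= t * g 0 1 & 2 <= s * g 0 0 + t * g 0 1]) /\
  (forall g, g \in gs -> exists s t : R, [/\ s ^+ 2 = 1, t ^+ 2 = 1,
     s * g 0 0 + t * g 0 1 = 2 &
     forall h, h \in gs -> h != g -> s * h 0 0 + t * h 0 1 < 2]).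

Section rotations.
Variable R : realType.
Implicit Types (x y g v : 'rV[R]_2) (gs : seq 'rV[R]_2).

Lemma turnK x : turn (turn x) = - x.
Proof. by apply: row2P; rewrite !mxE. Qed.

Lemma turnD x y : turn (x + y) = turn x + turn y.
Proof. by apply: row2P; rewrite !mxE /=; ring. Qed.

Lemma turnZ (a : R) x : turn (a *: x) = a *: turn x.
Proof. by apply: row2P; rewrite !mxE /=; ring. Qed.

Lemma turnN x : turn (- x) = - turn x.
Proof. by rewrite -scaleN1r turnZ scaleN1r. Qed.

Lemma dot_turn g x : dot (turn g) (turn x) = dot g x.
Proof. by rewrite /dot !mxE /=; ring. Qed.

Lemma cross_turn x y : cross (turn x) (turn y) = cross x y.
Proof. by rewrite /cross !mxE /=; ring. Qed.

Lemma gauge_map_turn gs x : gauge (map (@turn R) gs) x = gauge gs (- turn x).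
Proof.
rewrite /gauge big_map; apply: eq_bigr => g _.
by rewrite -(dot_turn g) turnN turnK opprK.
Qed.

Lemma sqr1_cases (s : R) : s ^+ 2 = 1 -> s = 1 \/ s = -1.
Proof. by move/eqP; rewrite sqrf_eq1 => /orP[]/eqP; [left|right]. Qed.

Lemma cornered_turn gs : cornered gs -> cornered (map (@turn R) gs).
Proof.
move=> [cover tight]; split=> [s t s1 t1|_ /mapP[g ggs ->]].
  have [||g ggs [g0 g1 g2]] := cover t (- s); rewrite ?sqrrN//.
  exists (turn g); first exact: map_f.
  by rewrite !mxE /=; split; lra.
have [s [t [s1 t1 gst hst]]] := tight g ggs.
exists (- t), s; rewrite sqrrN s1 t1 !mxE /=; split=> //; first lra.
move=> _ /mapP[h hgs ->] hg; rewrite !mxE /=.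
have : s * h 0 0 + t * h 0 1 < 2 by apply: hst => //; apply: contra hg => /eqP->.
lra.
Qed.

Lemma half_lattice (n : int) :
  exists s u : R, [/\ s ^+ 2 = 1, 2^-1 <= u & n%:~R - 2^-1 = s * u].
Proof.
have [n0|n0] := leP n 0.
  have {}n0 : (n%:~R : R) <= 0 by rewrite lerz0.
  by exists (-1), (2^-1 - n%:~R); rewrite sqrrN expr1n; split=> //; lra.
have {}n0 : (1 : R) <= n%:~R by rewrite ler1z -gtz0_ge1.
by exists 1, (n%:~R - 2^-1); rewrite expr1n; split=> //; lra.
Qed.

Lemma half_corner (s : R) : s ^+ 2 = 1 ->
  exists n : int, n%:~R - 2^-1 = s / 2.
Proof.
by move/sqr1_cases => [->|->]; [exists 1|exists 0]; rewrite ?mulr1z ?mulr0z; lra.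
Qed.

(** Every lattice point lies in the quadrant behind one of the four corners and is cut off with it.
    The corners are themselves lattice points, which gives the tight point on each edge. *)
Lemma cornered_maximal gs : cornered gs ->
  maximal_lattice_free (polyhedron (half_point R) gs).
Proof.
move=> [cover tight]; apply: maximal_polyhedron => [z|g ggs].
  have [s [u [s1 u2 zs]]] := half_lattice (z 0 0).
  have [t [w [t1 w2 zt]]] := half_lattice (z 0 1).
  have [g ggs [g0 g1 g2]] := cover _ _ s1 t1; exists g => //.
  rewrite /dot !mxE /= zs zt; nra.
have [s [t [s1 t1 gst hst]]] := tight g ggs.
have [m mE] := half_corner s1; have [n nE] := half_corner t1.
exists (\row_j [:: m; n]`_j).
  by rewrite /dot !mxE /= mE nE; lra.
by move=> h hgs hg; rewrite /dot !mxE /= mE nE; have := hst h hgs hg; lra.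
Qed.

Lemma half_interior gs : (polyhedron (half_point R) gs)° (half_point R).
Proof. by rewrite polyhedron_interior => g _; rewrite subrr dot0r. Qed.

Lemma closure_triangle k (r : 'I_k -> 'rV[R]_2) s g0 g1 g2 :
  triangle_closure (half_point R) r s ->
  0 < cross g0 g1 -> 0 < cross g1 g2 -> 0 < cross g2 g0 ->
  cornered [:: g0; g1; g2] ->
  1 <= \sum_(j < k) gauge [:: g0; g1; g2] (r j) * s 0 j.
Proof.
move=> [_ sT] c01 c12 c20 cg.
rewrite (eq_bigr (fun j => psi (half_point R)
    (polyhedron (half_point R) [:: g0; g1; g2]) (r j) * s 0 j)).
  apply: sT; split; [exact: cornered_maximal|exact: triangle_polyhedron|].
  exact: half_interior.
by move=> j _; rewrite psi_polyhedron.
Qed.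

Definition orbit_gauge gs x : R :=
  gauge gs x + gauge gs (turn x) + gauge gs (- x) + gauge gs (- turn x).

Lemma closure_orbit k (r : 'I_k -> 'rV[R]_2) s g0 g1 g2 :
  triangle_closure (half_point R) r s ->
  0 < cross g0 g1 -> 0 < cross g1 g2 -> 0 < cross g2 g0 ->
  cornered [:: g0; g1; g2] ->
  4 <= \sum_(j < k) orbit_gauge [:: g0; g1; g2] (r j) * s 0 j.
Proof.
move=> sT c01 c12 c20 cg.
have cr := cornered_turn cg; have crr := cornered_turn cr.
have crrr := cornered_turn crr.
have h0 := closure_triangle sT c01 c12 c20 cg.
have := closure_triangle sT _ _ _ cr; rewrite !cross_turn => /(_ c01 c12 c20) h1.
have := closure_triangle sT _ _ _ crr; rewrite !cross_turn => /(_ c01 c12 c20) h2.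
have := closure_triangle sT _ _ _ crrr; rewrite !cross_turn => /(_ c01 c12 c20) h3.
have -> : \sum_(j < k) orbit_gauge [:: g0; g1; g2] (r j) * s 0 j =
    \sum_(j < k) gauge [:: g0; g1; g2] (r j) * s 0 j +
    \sum_(j < k) gauge (map (@turn R) (map (@turn R) (map (@turn R) [:: g0; g1; g2])))
      (r j) * s 0 j +
    \sum_(j < k) gauge (map (@turn R) (map (@turn R) [:: g0; g1; g2]))
      (r j) * s 0 j +
    \sum_(j < k) gauge (map (@turn R) [:: g0; g1; g2]) (r j) * s 0 j.
  move: [:: g0; g1; g2] => gs; rewrite -!big_split; apply: eq_bigr => j _ /=.
  by rewrite -!mulrDl /orbit_gauge !gauge_map_turn !(turnN, turnK, opprK).
move: h0 h1 h2 h3 => /=; lra.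
Qed.

Lemma orbit_gauge_turn gs x : orbit_gauge gs (turn x) = orbit_gauge gs x.
Proof. by rewrite /orbit_gauge turnK opprK; ring. Qed.

Lemma orbit_gaugeZ gs (a : R) x :
  orbit_gauge gs (a *: x) = `|a| * orbit_gauge gs x.
Proof.
have pos (b : R) y : 0 <= b -> orbit_gauge gs (b *: y) = b * orbit_gauge gs y.
  by move=> b0; rewrite /orbit_gauge turnZ -!scalerN !gaugeZ// !mulrDr.
have [a0|a0] := ger0P a; first exact: pos.
rewrite -{1}[a]opprK scaleNr -scalerN pos ?oppr_ge0 ?ltW//.
by rewrite -turnK !orbit_gauge_turn.
Qed.

Lemma orbit_gaugeD gs x y :
  orbit_gauge gs (x + y) <= orbit_gauge gs x + orbit_gauge gs y.
Proof.
rewrite /orbit_gauge turnD !opprD.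
have := gaugeD gs x y; have := gaugeD gs (turn x) (turn y).
have := gaugeD gs (- x) (- y); have := gaugeD gs (- turn x) (- turn y); lra.
Qed.

Definition square_edges v : seq 'rV[R]_2 :=
  let w := (dot v v)^-1 *: (v + turn v) in [:: w; turn w; - w; - turn w].

Lemma square_coords v x : dot v v != 0 ->
  x = (dot v x / dot v v) *: v + (dot (turn v) x / dot v v) *: turn v.
Proof.
by rewrite /dot => vv; apply: row2P; rewrite !mxE /=; field.
Qed.

Lemma gauge_square v x : dot v v != 0 ->
  gauge (square_edges v) x = `|dot v x / dot v v| + `|dot (turn v) x / dot v v|.
Proof.
move=> vv; set a := dot v x / _; set b := dot (turn v) x / _.
have aE : a = dot v x / dot v v by [].
have bE : b = dot (turn v) x / dot v v by [].
have d0 : dot ((dot v v)^-1 *: (v + turn v)) x = a + b.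
  by rewrite aE bE /dot !mxE; ring.
have d1 : dot (turn ((dot v v)^-1 *: (v + turn v))) x = b - a.
  by rewrite aE bE /dot !mxE /=; ring.
apply/le_anti/andP; split.
  apply/gauge_leP; split; first by rewrite addr_ge0.
  move=> g; rewrite !inE => /or4P[]/eqP->; rewrite ?dotNl ?d0 ?d1;
  have := ler_norm a; have := ler_norm b; have := ler_norm (- a);
  have := ler_norm (- b); rewrite !normrN; lra.
have le g : g \in square_edges v -> dot g x <= gauge (square_edges v) x.
  exact: le_gauge.
have := le _ (mem_head _ _).
have := le (turn ((dot v v)^-1 *: (v + turn v))).
have := le (- ((dot v v)^-1 *: (v + turn v))).
have := le (- turn ((dot v v)^-1 *: (v + turn v))).
rewrite !inE !eqxx ?orbT !dotNl d0 d1 => /(_ isT) ? /(_ isT) ? /(_ isT) ? ?.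
by case: (ger0P a) => _; case: (ger0P b) => _; lra.
Qed.

End rotations.

Section squares.
Variables (R : realType) (f : 'rV[R]_2).
Implicit Types v x : 'rV[R]_2.

Definition square_vertices v : seq 'rV[R]_2 :=
  [:: f + v; f - turn v; f - v; f + turn v].

Lemma polyhedron_square v x : dot v v != 0 ->
  polyhedron f (square_edges v) x <->
  `|dot v (x - f) / dot v v| + `|dot (turn v) (x - f) / dot v v| <= 1.
Proof.
move=> vv; rewrite -gauge_square//; split; first by move=> h; apply/gauge_leP.
by move/gauge_leP => [].
Qed.

Lemma square_hull v : dot v v != 0 ->
  convex_hull [set` square_vertices v] = polyhedron f (square_edges v).
Proof.
move=> vv; set H := convex_hull _.
have cH : @convex_set R 'rV[R]_2 H by exact: convex_hull_convex.
have rvv : dot (turn v) v = 0 by rewrite /dot !mxE /=; ring.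
have vrv : dot v (turn v) = 0 by rewrite /dot !mxE /=; ring.
apply/seteqP; split=> x.
  apply: smallest_sub; first exact: convex_polyhedron.
  move=> w /=; rewrite !inE => /or4P[]/eqP->; apply/polyhedron_square => //;
    rewrite addrAC subrr add0r ?dotN ?dot_turn ?rvv ?vrv ?mulNr ?divff//;
    by rewrite ?oppr0 ?mul0r ?normrN ?normr0 ?normr1 ?addr0 ?add0r.
move=> /(polyhedron_square _ vv); set s := _ / _; set t := _ / dot v v => st.
have in_hull w : w \in square_vertices v -> H w.
  by move=> wv; apply: sub_convex_hull.
have fH : H f.
  have -> : f = 2^-1 *: (f + v) + 2^-1 *: (f - v) + 0 *: (f + v).
    by apply: row2P; rewrite !mxE; lra.
  by apply: (convex_comb3 cH); try lra; apply: in_hull; rewrite !inE eqxx ?orbT.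
have dir a u : H (f + u) -> H (f - u) -> exists2 w, H w & a *: u = `|a| *: (w - f).
  move=> pu nu; have [a0|a0] := ger0P a.
    by exists (f + u) => //; rewrite addrAC subrr add0r.
  by exists (f - u) => //; rewrite addrAC subrr add0r scalerN scaleNr opprK.
have [||w1 w1H w1E] := dir s v; try by apply: in_hull; rewrite !inE eqxx ?orbT.
have [||w2 w2H w2E] := dir t (turn v); try by apply: in_hull; rewrite !inE eqxx ?orbT.
have -> : x = `|s| *: w1 + `|t| *: w2 + (1 - `|s| - `|t|) *: f.
  rewrite -[LHS](subrK f) (square_coords (x - f) vv) -/s -/t w1E w2E.
  by apply: row2P; rewrite !mxE; ring.
by apply: (convex_comb3 cH) => //; try lra; exact: normr_ge0.
Qed.

Lemma square_polygon v : dot v v != 0 ->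
  polygon_with_vertices (square_vertices v) (polyhedron f (square_edges v)).
Proof.
move=> vv0; have vv : 0 < dot v v.
  by rewrite lt_def vv0 /dot -!expr2 addr_ge0 ?sqr_ge0.
have rvv : dot (turn v) v = 0 by rewrite /dot !mxE /=; ring.
have vrv : dot v (turn v) = 0 by rewrite /dot !mxE /=; ring.
pose us := [:: v; - turn v; - v; turn v].
have usP u : u \in us -> 0 < dot u u.
  by rewrite !inE => /or4P[]/eqP->; rewrite ?(dotN, dotNl, dot_turn, opprK).
have dots u w : u \in us -> w \in us -> w != u -> dot u w <= 0.
  rewrite !inE => /or4P[]/eqP-> /or4P[]/eqP->; rewrite ?eqxx// => _;
    by rewrite !(dotN, dotNl, dot_turn, rvv, vrv) ?oppr0 ?opprK// oppr_le0 ltW.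
have vsE : square_vertices v = [seq f + u | u <- us] by [].
split; last 1 first.
- rewrite vsE => _ /mapP[u uus ->].
  have sf x : f + x - f = x by rewrite addrAC subrr add0r.
  apply: (@extreme_not_hull _ f _ _ u 0) => [_ /mapP[w wus ->]|].
    by rewrite (inj_eq (addrI f)) sf; exact: dots.
  by rewrite sf usP.
- rewrite /= !inE !(inj_eq (addrI f)) !negb_or !andbT.
  have d g x y : dot g x != dot g y -> x != y by apply: contraNneq => ->.
  apply/and3P; split; [apply/and3P; split|apply/andP; split|].
  + by apply: (d v); rewrite dotN vrv oppr0.
  + by apply: (d v); rewrite dotN; lra.
  + by apply: (d v); rewrite vrv.
  + by apply: (d v); rewrite !dotN vrv oppr0 eq_sym oppr_eq0.
  + by apply: (d (turn v)); rewrite dotN dot_turn; lra.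
  + by apply: (d v); rewrite dotN vrv oppr_eq0.
- by rewrite square_hull.
Qed.

End squares.

Lemma family_vertices (R : realType) (a b : R) :
  [:: pt (1 + a) (1 - b); pt (1 - b) (- a); pt (- a) b; pt b (1 + a)] =
  square_vertices (half_point R) (pt (2^-1 + a) (2^-1 - b)).
Proof.
by congr [:: _; _; _; _]; apply: row2P; rewrite !mxE /=; lra.
Qed.

Lemma cornered_triangle (R : realType) (a b : R) :
  0 < a -> a < 2 -> 0 < b -> b < 2 ->
  cornered [:: pt (- 2) 0; pt b (b - 2); pt a (2 - a)].
Proof.
move=> a0 a2 b0 b2; split=> [s t /sqr1_cases[]-> /sqr1_cases[]->|g].
- by exists (pt a (2 - a)); rewrite ?inE ?eqxx ?orbT// !mxE /=; split; lra.
- by exists (pt b (b - 2)); rewrite ?inE ?eqxx ?orbT// !mxE /=; split; lra.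
- by exists (pt (- 2) 0); rewrite ?inE ?eqxx ?orbT// !mxE /=; split; lra.
- by exists (pt (- 2) 0); rewrite ?inE ?eqxx ?orbT// !mxE /=; split; lra.
rewrite !inE => /or3P[]/eqP->; [exists (-1), 1|exists 1, (-1)|exists 1, 1];
  rewrite ?sqrrN ?expr1n !mxE /=; split; rewrite //; try lra;
  by move=> h; rewrite !inE => /or3P[]/eqP->; rewrite ?eqxx// => _;
    rewrite !mxE /=; lra.
Qed.

Section orbits.
Variable R : realType.
Implicit Types (p q a b : R) (v x : 'rV[R]_2) (gs : seq 'rV[R]_2).

Lemma orbit_gauge_square gs v x : dot v v != 0 ->
  orbit_gauge gs x <= gauge (square_edges v) x * orbit_gauge gs v.
Proof.
move=> vv; rewrite {1}(square_coords x vv); apply: le_trans (orbit_gaugeD _ _ _) _.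
by rewrite !orbit_gaugeZ orbit_gauge_turn gauge_square// [leRHS]mulrDl.
Qed.

Lemma orbit_gauge_le a b p q m0 m1 m2 m3 :
  0 <= m0 -> 0 <= m1 -> 0 <= m2 -> 0 <= m3 ->
  [/\ - 2 * p <= m0, b * p + (b - 2) * q <= m0 & a * p + (2 - a) * q <= m0] ->
  [/\ 2 * q <= m1, - (b * q) + (b - 2) * p <= m1 & - (a * q) + (2 - a) * p <= m1] ->
  [/\ 2 * p <= m2, - (b * p) - (b - 2) * q <= m2 & - (a * p) - (2 - a) * q <= m2] ->
  [/\ - 2 * q <= m3, b * q - (b - 2) * p <= m3 & a * q - (2 - a) * p <= m3] ->
  orbit_gauge [:: pt (- 2) 0; pt b (b - 2); pt a (2 - a)] (pt p q) <=
  m0 + m1 + m2 + m3.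
Proof.
move=> m0_ge m1_ge m2_ge m3_ge [? ? ?] [? ? ?] [? ? ?] [? ? ?].
rewrite /orbit_gauge; apply: lerD; [apply: lerD; [apply: lerD|]|];
  apply/gauge_leP; split=> // g; rewrite !inE => /or3P[]/eqP->;
  rewrite /dot !mxE /=; lra.
Qed.

(* The apex of the triangle is placed on the ray through (p, q), and a is such
   that the upper edge meets the base on the ray through (-q, p). *)
Lemma orbit_gauge_pos p q : p ^+ 2 + q ^+ 2 = p -> 0 < q -> q < p ->
  exists a b, [/\ 0 < a, a < 2, 0 < b, b < 2 &
    orbit_gauge [:: pt (- 2) 0; pt b (b - 2); pt a (2 - a)] (pt p q) <= 9 / 2].
Proof.
move=> pq q0 qp; have p0 : 0 < p by lra.
have s0 : 0 < p + q by lra.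
have sn : p + q != 0 by rewrite gt_eqF.
pose a := 2 * (p - q) / (p + q).
pose b := 2 * (p ^+ 2 + 3 * q ^+ 2) / (p + q) ^+ 2.
have aE : a * p + a * q = 2 * p - 2 * q by rewrite /a; field.
have bE : b * p + b * q = a * p - a * q + 4 * q by rewrite /a /b; field.
have a0 : 0 < a by rewrite /a divr_gt0//; lra.
have a2 : a < 2 by rewrite /a ltr_pdivrMr//; lra.
have b0 : 0 < b by rewrite /b divr_gt0 ?exprn_gt0//; nra.
have b2 : b < 2 by rewrite /b ltr_pdivrMr ?exprn_gt0//; nra.
exists a, b; split=> //.
have ap := mulr_gt0 a0 p0; have aq := mulr_gt0 a0 q0.
have bp := mulr_gt0 b0 p0; have bq := mulr_gt0 b0 q0.
have ap2 : a * p < 2 * p by rewrite ltr_pM2r.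
have aq2 : a * q < 2 * q by rewrite ltr_pM2r.
have bp2 : b * p < 2 * p by rewrite ltr_pM2r.
have bq2 : b * q < 2 * q by rewrite ltr_pM2r.
have sumE : a * p + (2 - a) * q + 2 * q + 2 * p + (b * q + (2 - b) * p) =
    4 * (p ^+ 2 + q ^+ 2) * (p + 3 * q) / (p + q) ^+ 2.
  by rewrite /a /b; field.
apply: (@le_trans _ _ (a * p + (2 - a) * q + 2 * q + 2 * p + (b * q + (2 - b) * p))).
  by clear sumE; clearbody a b; apply: orbit_gauge_le; try split; lra.
rewrite sumE pq ler_pdivrMr ?exprn_gt0//.
have := sqr_ge0 (p - 3 * q); nra.
Qed.

Lemma orbit_gauge_reflect a b p q :
  orbit_gauge [:: pt (- 2) 0; pt a (a - 2); pt b (2 - b)] (pt p (- q)) =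
  orbit_gauge [:: pt (- 2) 0; pt b (b - 2); pt a (2 - a)] (pt p q).
Proof.
have gE (x y : R) : gauge [:: pt (- 2) 0; pt a (a - 2); pt b (2 - b)] (pt x y) =
    gauge [:: pt (- 2) 0; pt b (b - 2); pt a (2 - a)] (pt x (- y)).
  rewrite /gauge !big_cons !big_nil /dot !mxE /=; congr Num.max; first ring.
  by rewrite maxCA; congr (Num.max _ (Num.max _ _)); ring.
have oE gs (x y : R) : orbit_gauge gs (pt x y) = gauge gs (pt x y) +
    gauge gs (pt (- y) x) + gauge gs (pt (- x) (- y)) + gauge gs (pt y (- x)).
  rewrite /orbit_gauge; congr (_ + gauge _ _ + gauge _ _ + gauge _ _);
  by apply: row2P; rewrite !mxE /= ?opprK.
rewrite !oE !gE !opprK; ring.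
Qed.

Lemma exists_orbit_triangle p q : p ^+ 2 + q ^+ 2 = p -> - p < q -> q < p ->
  exists a b, [/\ 0 < a, a < 2, 0 < b, b < 2 &
    orbit_gauge [:: pt (- 2) 0; pt b (b - 2); pt a (2 - a)] (pt p q) <= 9 / 2].
Proof.
move=> pq pq0 qp; have [q0|q0|q0] := ltgtP q 0.
- have [||| b [a [b0 b2 a0 a2 le]]] := @orbit_gauge_pos p (- q);
    rewrite ?sqrrN; try lra.
  by exists a, b; split=> //; rewrite -orbit_gauge_reflect.
- exact: orbit_gauge_pos.
- have p1 : p = 1.
    have : p * (p - 1) = 0 by move: pq; rewrite q0; lra.
    by move/eqP; rewrite mulf_eq0 => /orP[/eqP|/eqP]; lra.
  exists (3 / 2), (3 / 2); split; try lra.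
  apply: (@le_trans _ _ (3 / 2 + 1 / 2 + 2 + 1 / 2)); last lra.
  by rewrite q0 p1; apply: orbit_gauge_le; try split; lra.
Qed.

(* Two of the four corners are cut off by the same edge. *)
Lemma triangle_gauge_sum (g0 g1 g2 : 'rV[R]_2) : let gs := [:: g0; g1; g2] in
  (forall s t : R, s ^+ 2 = 1 -> t ^+ 2 = 1 ->
     exists2 g, g \in gs & 2 <= s * g 0 0 + t * g 0 1) ->
  15 <= gauge gs (pt 3 1) + gauge gs (pt (- 1) 3) + gauge gs (pt (- 3) (- 1)) +
    gauge gs (pt 1 (- 3)).
Proof.
move=> gs cut.
have nE : (-1 : R) ^+ 2 = 1 by rewrite sqrrN expr1n.
have [ha haI ha2] := cut 1 1 (expr1n _ _) (expr1n _ _).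
have [hb hbI hb2] := cut (-1) 1 nE (expr1n _ _).
have [hc hcI hc2] := cut (-1) (-1) nE nE.
have [hd hdI hd2] := cut 1 (-1) (expr1n _ _) nE.
have le g (x y : R) : g \in gs -> g 0 0 * x + g 0 1 * y <= gauge gs (pt x y).
  by move/(le_gauge (pt x y)); rewrite /dot !mxE.
have all (x y : R) : [/\ g0 0 0 * x + g0 0 1 * y <= gauge gs (pt x y),
    g1 0 0 * x + g1 0 1 * y <= gauge gs (pt x y) &
    g2 0 0 * x + g2 0 1 * y <= gauge gs (pt x y)].
  by split; apply: le; rewrite !inE eqxx ?orbT.
have [a0 a1 a2] := all 3 1; have [b0 b1 b2] := all (- 1) 3.
have [c0 c1 c2] := all (- 3) (- 1); have [d0 d1 d2] := all 1 (- 3).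
clear cut le all; move: haI hcI; rewrite !inE => /or3P[]/eqP ? /or3P[]/eqP ?;
  subst ha hc; try (exfalso; lra);
  move: hbI hdI; rewrite !inE => /or3P[]/eqP ? /or3P[]/eqP ?;
  subst hb hd; try (exfalso; clear a0 a1 a2 b0 b1 b2 c0 c1 c2 d0 d1 d2; lra);
  lra.
Qed.

End orbits.

Lemma lattice_free_cut (R : realType) (gs : seq 'rV[R]_2) (s t : R) :
  lattice_free_convex (polyhedron (half_point R) gs) ->
  s ^+ 2 = 1 -> t ^+ 2 = 1 ->
  exists2 g, g \in gs & 2 <= s * g 0 0 + t * g 0 1.
Proof.
move=> [_ free] s1 t1.
have [m mE] := half_corner s1; have [n nE] := half_corner t1.
apply: contrapT => nocut; apply: (free (\row_j [:: m; n]`_j)).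
rewrite polyhedron_interior => g ggs; rewrite ltNge; apply/negP => cut.
apply: nocut; exists g => //; move: cut; rewrite /dot !mxE /= mE nE; lra.
Qed.

Lemma quadrilateral_cut (R : realType) (k : nat) (r : 'I_k -> 'rV[R]_2)
    (s : 'rV[R]_k) (B : set 'rV[R]_2) :
  triangle_closure (half_point R) r s -> quadrilateral_family B ->
  8 / 9 <= \sum_(j < k) psi (half_point R) B (r j) * s 0 j.
Proof.
move=> sT [_ [a [b [a0 b0 ab [_ -> _]]]]].
rewrite family_vertices; set v := pt _ _.
have b1 : b < 1 by nra.
have pq : (2^-1 + a) ^+ 2 + (2^-1 - b) ^+ 2 = 2^-1 + a.
  rewrite !expr2 in ab *; lra.
have vv : dot v v = 2^-1 + a by rewrite -[RHS]pq /dot !mxE /= -!expr2.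
have vv0 : dot v v != 0 by rewrite vv gt_eqF//; lra.
rewrite square_hull//.
have [||c [d [c0 c2 d0 d2 orb]]] := exists_orbit_triangle pq; try lra.
have := closure_orbit sT _ _ _ (cornered_triangle c0 c2 d0 d2).
rewrite /cross !mxE /= => h; have {h} h4 := h ltac:(lra) ltac:(nra) ltac:(lra).
have [s0 _] := sT.
set gs := [:: _; _; _] in orb h4; set Q := polyhedron _ _.
have : \sum_(j < k) orbit_gauge gs (r j) * s 0 j
    <= \sum_(j < k) 9 / 2 * (psi (half_point R) Q (r j) * s 0 j).
  apply: ler_sum => j _; rewrite psi_polyhedron mulrA ler_wpM2r//.
  apply: le_trans (orbit_gauge_square _ (r j) vv0) _.
  by rewrite mulrC ler_wpM2r// gauge_ge0.
rewrite -mulr_sumr; lra.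
Qed.

Definition worst_square (R : realType) : set 'rV[R]_2 :=
  polyhedron (half_point R) (square_edges (pt (9 / 10) (3 / 10))).

Lemma worst_square_in_family (R : realType) : quadrilateral_family (@worst_square R).
Proof.
pose v : 'rV[R]_2 := pt (9 / 10) (3 / 10).
have vv : dot v v = 9 / 10 by rewrite /dot !mxE /=; lra.
split; last first.
  exists (2 / 5), (1 / 5); split; [lra|lra|lra|].
  rewrite family_vertices (_ : pt _ _ = v); last first.
    by apply: row2P; rewrite !mxE /=; lra.
  by apply: square_polygon; rewrite vv; lra.
apply: cornered_maximal; rewrite /square_edges -/v vv.
rewrite (_ : _ *: _ = pt (2 / 3) (4 / 3)); last first.
  by apply: row2P; rewrite !mxE /=; lra.
split=> [s t /sqr1_cases[]-> /sqr1_cases[]->|g].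
- by exists (pt (2 / 3) (4 / 3)); rewrite ?inE ?eqxx ?orbT// !mxE /=; split; lra.
- by exists (- turn (pt (2 / 3) (4 / 3)));
    rewrite ?inE ?eqxx ?orbT// !mxE /=; split; lra.
- by exists (turn (pt (2 / 3) (4 / 3)));
    rewrite ?inE ?eqxx ?orbT// !mxE /=; split; lra.
- by exists (- pt (2 / 3) (4 / 3));
    rewrite ?inE ?eqxx ?orbT// !mxE /=; split; lra.
rewrite !inE => /or4P[]/eqP->;
  [exists 1, 1|exists (-1), 1|exists (-1), (-1)|exists 1, (-1)];
  rewrite ?sqrrN ?expr1n !mxE /=; split; rewrite //; try lra;
  by move=> h; rewrite !inE => /or4P[]/eqP->; rewrite ?eqxx// => _;
    rewrite !mxE /=; lra.
Qed.

Definition corner_ray (j : 'I_4) : 'rV[rat]_2 :=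
  \row_i (nth [::] [:: [:: 3; 1]; [:: -1; 3]; [:: -3; -1]; [:: 1; -3]] j)`_i.

Lemma sum_corner_rays (R : realType) (F : 'rV[R]_2 -> R) :
  \sum_(j < 4) F (map_mx (@ratr R) (corner_ray j)) =
  F (pt 3 1) + F (pt (- 1) 3) + F (pt (- 3) (- 1)) + F (pt 1 (- 3)).
Proof.
rewrite !big_ord_recl big_ord0 addr0 !addrA.
by congr (F _ + F _ + F _ + F _); apply: row2P;
  rewrite !mxE /= ?rmorphN /= ?rmorph1 ?ratr_nat.
Qed.

Theorem theorem4p1 (R : realType) :
  is_least
    [set alpha : R | 0 < alpha /\
       forall (k : nat) (r : 'I_k -> 'rV[rat]_2),
         (0 < k)%N -> (forall j, r j != 0) ->
         let rR := fun j : 'I_k => map_mx (@ratr R) (r j) in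
         triangle_closure (half_point R) rR `<=`
           cut_scale alpha (X_relaxation rR)]
    (9 / 8).
Proof.
split=> [|alpha [alpha0 sub]].
  split=> [|k r _ _ rR s sT]; first by rewrite divr_gt0.
  have [s0 sB] := sT.
  have scale (B : set 'rV[R]_2) :
      \sum_(j < k) psi (half_point R) B (rR j) * (9 / 8 *: s) 0 j =
      9 / 8 * \sum_(j < k) psi (half_point R) B (rR j) * s 0 j.
    by rewrite mulr_sumr; apply: eq_bigr => j _; rewrite mxE mulrCA.
  have scale0 j : 0 <= (9 / 8 *: s) 0 j.
    by rewrite mxE mulr_ge0// divr_ge0.
  split; split=> // B BF; rewrite scale; first by have := sB B BF; lra.
  by have := quadrilateral_cut sT BF; lra.
pose s : 'rV[R]_4 := const_mx (1 / 15).
have sT : triangle_closure (half_point R)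
    (fun j => map_mx (@ratr R) (corner_ray j)) s.
  split=> [j|B [[freeB _] triB Bf]]; first by rewrite mxE; lra.
  under eq_bigr do rewrite mxE.
  rewrite -mulr_suml (sum_corner_rays (psi (half_point R) B)).
  have [g0 [g1 [g2 BE]]] := triangle_is_polyhedron triB Bf.
  rewrite BE in freeB *; rewrite !psi_polyhedron.
  have := @triangle_gauge_sum _ g0 g1 g2 (fun s t => lattice_free_cut freeB); lra.
have nz j : corner_ray j != 0.
  apply/eqP => /rowP/(_ 0); rewrite !mxE.
  by case: j => -[|[|[|[|//]]]].
have [_ [_ /(_ _ (worst_square_in_family R))]] := sub 4 corner_ray isT nz s sT.
under eq_bigr do rewrite !mxE.
rewrite -mulr_suml (sum_corner_rays (psi (half_point R) _)).
have gle (x y : R) : -10 <= 2 * x + 4 * y <= 10 -> -10 <= 4 * x - 2 * y <= 10 ->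
    gauge (square_edges (pt (9 / 10) (3 / 10))) (pt x y) <= 10 / 3.
  move=> /andP[? ?] /andP[? ?]; rewrite gauge_square /dot !mxE /=; last lra.
  rewrite [X in `|X| + _](_ : _ = x + y / 3); last by field.
  rewrite [X in _ + `|X|](_ : _ = y - x / 3); last by field.
  by case: ger0P => _; case: ger0P => _; lra.
rewrite /worst_square !psi_polyhedron => le1.
have r0 := gle 3 1 ltac:(lra) ltac:(lra).
have r1 := gle (- 1) 3 ltac:(lra) ltac:(lra).
have r2 := gle (- 3) (- 1) ltac:(lra) ltac:(lra).
have r3 := gle 1 (- 3) ltac:(lra) ltac:(lra).
have : 1 <= 40 / 3 * (alpha * (1 / 15)).
  by apply: le_trans le1 _; rewrite ler_wpM2r//; lra.
lra.
Qed.
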